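(* Let $G$ be a graph, $k\ge3$, and $U$ a set of $k$ elements disjoint from $V(G)$. If the $k$-suspension $G^U$ has a spanning tree, then $G^U$ has no 3-Pfaffian orientation.
   Context: The suspension $G^U$ of a graph $G=(V,E)$ from a finite set $U$ disjoint from $V$ is the 3-graph on $U\cup V$ with triples $\{i,j,u\}$ for all $ij\in E$ and $u\in U$; if $|U|=k$ it is a $k$-suspension. A cycle in a 3-graph is a sequence $a_0,t_1,a_1,\dots,t_\ell,a_\ell=a_0$, $\ell\ge2$, of distinct vertices $a_0,\dots,a_{\ell-1}$ and distinct triples with $a_{i-1},a_i\in t_i$; a spanning tree is a set of triples with no cycle, covering all vertices, connected via paths of triples. Identify the vertex set with $[N]$ via a linear order. A triple orientation $\omega$ assigns each triple $t=\{i,j,k\}$ a 3-cycle $\sigma(t,\omega)\in\{(i\,j\,k),(j\,i\,k)\}$; for a spanning tree $T$, $\prod_{t\in T}\sigma(t,\omega)$ is an $N$-cycle $(s(1)\cdots s(N))$ and $\mathrm{sgn}(T,\omega)$ is the sign of $s$ (well defined). $\omega$ is 3-Pfaffian if $\mathrm{sgn}(T,\omega)$ is constant over all spanning trees. *)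

(* Defs.v *)
From mathcomp Require Import all_boot all_order all_fingroup all_algebra.

Set Implicit Arguments.
Unset Strict Implicit.
Unset Printing Implicit Defensive.

(* A (finite, simple) graph on V is a symmetric irreflexive relation on V, and
   a 3-graph on W is a set of 3-element subsets of W. *)

(* The disjoint union of the vertex sets is the sum type U + V. *)
Definition suspension (U V : finType) (e : rel V) : {set {set U + V}} :=
  [set t : {set U + V} | [exists i : V, exists j : V, exists u : U,
     e i j && (t == [set inr i; inr j; inl u])]].

Section ThreeGraph.

Variable W : finType.
Implicit Types (H T : {set {set W}}) (w : {set W} -> {perm W}).

(* The indices of the closed sequence a_0, t_1, a_1, ..., t_l, a_l = a_0 are
   taken in 'I_l, ordS being the cyclic successor: [t i] is the triple lying
   between [a i] and [a (ordS i)]. *)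
Definition has_cycle T : Prop :=
  exists (l : nat) (a : 'I_l -> W) (t : 'I_l -> {set W}),
    [/\ 2 <= l, injective a, injective t &
        forall i, [/\ t i \in T, a i \in t i & a (ordS i) \in t i]].

Definition share_triple T : rel W :=
  [rel x y | [exists t in T, (x \in t) && (y \in t)]].

Definition spanning_tree H T : Prop :=
  [/\ T \subset H, ~ has_cycle T, cover T = [set: W] &
      forall x y : W, connect (share_triple T) x y].

(* The 3-cycle i -> j -> k -> i; products of permutations apply the left factor
   first. *)
Definition cycle3 (i j k : W) : {perm W} := (tperm i j * tperm i k)%g.

(* The two possible values (i j k) and (j i k) on a triple correspond to the
   possible orders in which its elements are listed. The values of w outside
   H are irrelevant. *)
Definition triple_orientation H w : Prop :=
  forall t, t \in H -> exists i j k : W,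
    [/\ uniq [:: i; j; k], t = [set i; j; k] & w t = cycle3 i j k].

(* A linear order on W is given as a bijection v : 'I_N -> W, [v i] being the
   i-th vertex. The predicate says that c is the N-cycle (s(0) ... s(N-1)). *)
Definition is_Ncycle (N : nat) (v : 'I_N -> W) (c : {perm W}) (s : 'S_N) : bool :=
  [forall i : 'I_N, c (v (s i)) == v (s (ordS i))].

(* The product is taken in the order of the enumeration of T. When T is a
   spanning tree it is an N-cycle whatever the order of the factors, and the
   sign of s depends neither on that order nor on the choice of s (N is then
   odd, so rotating s does not change its sign). The value 0 is for sets T whose
   product is not an N-cycle. *)
Definition sgn (N : nat) (v : 'I_N -> W) w T : int :=
  if [pick s : 'S_N | is_Ncycle v (\prod_(t in T) w t)%g s] is Some s
  then ((-1) ^+ s)%R else 0%R.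

Definition pfaffian3 (N : nat) (v : 'I_N -> W) H w : Prop :=
  forall T1 T2, spanning_tree H T1 -> spanning_tree H T2 ->
    sgn v w T1 = sgn v w T2.

End ThreeGraph.

(* Main.v *)
(* A spanning tree T of the suspension contains two triples {a,b,p}, {a,c,q} with
   a, b, c in V and distinct p, q in U, and the rest R of T is obtained by
   attaching triples one after another, each along a single vertex, to
   {a,b,c,p,q}. Exchanging p and q in these two triples and keeping R gives
   another spanning tree T'. Attaching a triple inserts two vertices in the
   N-cycle and changes the sign in a way that depends only on the triple, so
   the signs of T and T' are compared on five vertices: there (a b p c q)
   becomes (a b q c p), an odd change. Hence, if f u counts modulo 2 the triples
   {a,b,u}, {a,c,u} not oriented as (a b u), (a c u), constancy of the sign
   forces f p != f q. Permuting U in T gives the same for every pair of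
   elements of U, which is impossible for three elements and a boolean f. *)
Require Import Defs.
From mathcomp Require Import all_boot all_order all_fingroup all_algebra.

Set Implicit Arguments.
Unset Strict Implicit.
Unset Printing Implicit Defensive.

(** * Parity of rearrangements of vertex lists *)

Section CyclicOrders.

Variable W : finType.
Implicit Types (a b c x y z : W) (l m : seq W) (g : {perm W}) (d : bool)
  (t : {set W}) (ts : seq {set W}) (w : {set W} -> {perm W}) (C : {set W}).

(** The parity is carried by a permutation of [W] that fixes everything off [l], so it composes
    along successive rearrangements and survives putting common elements in front. It is determined
    by the two lists. *)
Definition rearr d l l' : Prop :=
  exists g, [/\ odd_perm g = d, forall x, x \notin l -> g x = x & l' = map g l].

Lemma rearr_refl l : rearr false l l.
Proof.
exists 1%g; split=> [|x _|]; [exact: odd_perm1 | exact: perm1 |].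
by rewrite (eq_map (@perm1 W)) map_id.
Qed.

Lemma rearr_supp g l : (forall x, x \notin l -> g x = x) ->
  forall x, (g x \in l) = (x \in l).
Proof.
move=> gl x; apply/idP/idP; apply: contraTT => xl; first by rewrite gl.
by have /perm_inj gx := gl _ xl; rewrite gx in xl.
Qed.

Lemma rearr_mem d l l' : rearr d l l' -> l =i l'.
Proof.
move=> [g [_ gl ->]] x.
by rewrite -{2}(permKV g x) (mem_map perm_inj) -[RHS](rearr_supp gl) permKV.
Qed.

Lemma rearr_uniq d l l' : rearr d l l' -> uniq l' = uniq l.
Proof. by move=> [g [_ _ ->]]; rewrite (map_inj_uniq perm_inj). Qed.

Lemma rearr_size d l l' : rearr d l l' -> size l' = size l.
Proof. by move=> [g [_ _ ->]]; rewrite size_map. Qed.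

Lemma rearr_trans d d' l l' l'' :
  rearr d l l' -> rearr d' l' l'' -> rearr (d (+) d') l l''.
Proof.
move=> rl; have ml := rearr_mem rl; case: rl ml => g [<- gl ->] ml.
move=> [h [<- hl ->]]; exists (g * h)%g; split; first by rewrite odd_permM.
  by move=> x xl; rewrite permM gl // hl // -ml.
by rewrite -map_comp; apply: eq_map => x /=; rewrite permM.
Qed.

Lemma rearr_sym d l l' : rearr d l l' -> rearr d l' l.
Proof.
move=> rl; have ml := rearr_mem rl; case: rl ml => g [<- gl ->] ml.
exists g^-1%g; split; first by rewrite odd_permV.
  by move=> x; rewrite -ml => /gl {1}<-; rewrite permK.
by rewrite -map_comp (eq_map (permK g)) map_id.
Qed.

Lemma rearr_cons d x l l' :
  x \notin l -> rearr d l l' -> rearr d (x :: l) (x :: l').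
Proof.
move=> xl [g [gd gl ->]]; exists g; split=> //=; last by rewrite gl.
by move=> y; rewrite inE => /norP[_ /gl].
Qed.

Lemma rearr_cat d m l l' :
  uniq (m ++ l) -> rearr d l l' -> rearr d (m ++ l) (m ++ l').
Proof.
elim: m => //= x m IH /andP[xm um] rl.
by apply: rearr_cons => //; apply: IH.
Qed.

Lemma rearr_swap x y l : uniq (x :: y :: l) -> rearr true (x :: y :: l) (y :: x :: l).
Proof.
rewrite /= inE => /and3P[/norP[xy xl] yl _]; exists (tperm x y); split.
- by rewrite odd_tperm xy.
- by move=> z; rewrite !inE => /norP[zx /norP[zy _]]; rewrite tpermD // eq_sym.
- rewrite /= tpermL tpermR; congr [:: _, _ & _].
  rewrite -[LHS]map_id; apply/eq_in_map => z zl; rewrite tpermD //.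
    by apply: contraNneq xl => ->.
  by apply: contraNneq yl => ->.
Qed.

(** The head crosses the elements of [m] one at a time, each crossing being a transposition. *)
Lemma rearr_rcons x m : uniq (x :: m) -> rearr (odd (size m)) (x :: m) (rcons m x).
Proof.
elim: m x => [|y m IH] x uxm; first exact: rearr_refl.
move: (uxm); rewrite /= inE => /and3P[/norP[xy xm] ym um].
apply: (rearr_trans (d := true) (d' := odd (size m))) (rearr_swap uxm) _.
apply: rearr_cons; last by apply: IH; rewrite /= xm.
by rewrite inE negb_or eq_sym xy.
Qed.

(** Each one-step rotation carries the head past [size l - 1] elements, an even number. *)
Lemma rearr_rot i l : uniq l -> odd (size l) -> rearr false l (rot i l).
Proof.
move=> ul ol; case: (leqP i (size l)) => il; last first.
  by rewrite rot_oversize ?(ltnW il) //; apply: rearr_refl.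
elim: i il => [|i IH] il; first by rewrite rot0; apply: rearr_refl.
rewrite -[i.+1]add1n rotD ?add1n //.
apply: (rearr_trans (d := false) (d' := false)) (IH (ltnW il)) _.
have: uniq (rot i l) by rewrite rot_uniq.
have: odd (size (rot i l)) by rewrite size_rot.
case: (rot i l) => //= x m om um; rewrite rot1_cons.
by rewrite -(negbTE om); apply: rearr_rcons.
Qed.

(** * Permutations that act as one cycle along a list *)

Definition acts_as_cycle g l := uniq l /\ g =1 next l.

Lemma cycle3L a b c : uniq [:: a; b; c] -> cycle3 a b c a = b.
Proof.
rewrite /= !inE andbT => /andP[/norP[ab ac] bc].
by rewrite permM tpermL tpermD // eq_sym.
Qed.

Lemma cycle3M a b c : cycle3 a b c b = c.
Proof. by rewrite permM tpermR tpermL. Qed.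

Lemma cycle3R a b c : uniq [:: a; b; c] -> cycle3 a b c c = a.
Proof.
rewrite /= !inE andbT => /andP[/norP[ab ac] bc].
by rewrite permM (tpermD ac bc) tpermR.
Qed.

Lemma cycle3D a b c x : x \notin [:: a; b; c] -> cycle3 a b c x = x.
Proof.
by rewrite !inE !negb_or => /and3P[xa xb xc]; rewrite permM !tpermD // eq_sym.
Qed.

Lemma cycle3_rot a b c : uniq [:: a; b; c] -> cycle3 a b c = cycle3 b c a.
Proof.
move=> u; have u' : uniq [:: b; c; a] by rewrite -(rot_uniq 2).
apply/permP => x; case xl: (x \in [:: a; b; c]); last first.
  rewrite !cycle3D ?xl //; move: xl; rewrite !inE.
  by case: (x == a); case: (x == b); case: (x == c).
move: xl; rewrite !inE => /or3P[] /eqP ->.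
- by rewrite cycle3L // cycle3R.
- by rewrite cycle3M cycle3L.
- by rewrite cycle3R // cycle3M.
Qed.

Lemma cycle3J a b c g : (cycle3 a b c ^ g)%g = cycle3 (g a) (g b) (g c).
Proof. by rewrite conjMg !tpermJ. Qed.

Lemma next_notin l x : x \notin l -> next l x = x.
Proof. by move=> xl; rewrite next_nth (negbTE xl). Qed.

Lemma acts_as_cycle_rot g l i : acts_as_cycle g l -> acts_as_cycle g (rot i l).
Proof.
move=> [ul gl]; split; first by rewrite rot_uniq.
by move=> x; rewrite next_rot.
Qed.

(** Elements pass through [cycle3 a b c] first and then through [g], which fixes [b] and [c]. So [b]
    and [c] are visited right after [a], and [c] goes on to where [g] sent [a]. *)
Lemma acts_as_cycle_insert g a b c m :
    acts_as_cycle g (a :: m) -> uniq [:: a, b, c & m] ->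
  acts_as_cycle (cycle3 a b c * g)%g [:: a, b, c & m].
Proof.
move=> [um gm] u; split=> // x; rewrite permM gm.
have u3 : uniq [:: a; b; c].
  by move: u; rewrite -[_ :: _]/([:: a; b; c] ++ m) cat_uniq => /and3P[].
have [ab ac am bc [bm cm]] :
    [/\ a != b, a != c, a \notin m, b != c & b \notin m /\ c \notin m].
  by move: u; rewrite /= !inE !negb_or => /and4P[/and3P[-> -> ->] /andP[-> ->] ->].
have [->|xa] := eqVneq x a.
  by rewrite cycle3L // next_notin ?inE ?negb_or 1?eq_sym ?ab //= eqxx.
have [->|xb] := eqVneq x b.
  rewrite cycle3M next_notin ?inE ?negb_or 1?eq_sym ?ac //=.
  by rewrite (eq_sym b) (negbTE ab) eqxx.
have [->|xc] := eqVneq x c.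
  rewrite cycle3R //= (eq_sym c a) (negbTE ac) (eq_sym c b) (negbTE bc).
  by case: (m) => [|y m'] /=; rewrite !eqxx.
rewrite cycle3D ?inE ?negb_or ?xa ?xb ?xc //=.
rewrite (negbTE xa) (negbTE xb).
by case: (m) => [|y m'] /=; rewrite ?(negbTE xa) ?(negbTE xc).
Qed.

(* The order of the factors only matters up to an even rearrangement of l, which
   leaves the sign unchanged. *)
Definition tree_order w ts l : Prop :=
  [/\ uniq l, odd (size l),
      forall t x, t \in ts -> x \notin l -> w t x = x &
      forall L, perm_eq L ts -> exists2 l', rearr false l l' &
        acts_as_cycle (\prod_(t <- L) w t)%g l'].

Lemma tree_order1 w a : tree_order w [::] [:: a].
Proof.
split=> // L /perm_nilP ->; exists [:: a]; first exact: rearr_refl.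
split=> // x; rewrite big_nil perm1 /=.
by case: (x =P a).
Qed.

(** The factor of the new triple may stand anywhere, between products [X] and [Y]. Since [X] fixes
    [b] and [c], moving the factor to the front only replaces [a] by its preimage under [X], which
    is still in [l]; then [b] and [c] are inserted after that element. *)
Lemma tree_order_leaf w ts l t a b c :
    tree_order w ts l -> a \in l -> uniq [:: b, c & l] -> w t = cycle3 a b c ->
  tree_order w (t :: ts) [:: b, c & l].
Proof.
move=> [ul ol sl cl] al u wt.
move: (u); rewrite /= inE !negb_or => /and3P[/andP[bc bl] ncl _].
split=> //=; first by rewrite negbK.
  move=> t' x; rewrite !inE => /orP[/eqP ->|t'ts];
    rewrite !negb_or => /and3P[xb xc xl].
    rewrite wt cycle3D // !inE !negb_or xb xc !andbT.
    by apply: contraNneq xl => ->.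
  exact: sl t'ts xl.
move=> L pL; have tL : t \in L by rewrite (perm_mem pL) mem_head.
case/splitPr: tL pL => L1 L2; rewrite -cat1s perm_catCA /= perm_cons => pL.
have [l' rl' [ul' cl']] := cl _ pL; have ml := rearr_mem rl'.
move: cl'; rewrite big_cat /= big_cat big_cons wt.
set X := (\prod_(t <- L1) w t)%g; set Y := (\prod_(t <- L2) w t)%g => cXY.
have fX x : x \notin l -> X x = x.
  move=> xl; rewrite /X; have: {subset L1 <= ts}.
    by move=> t' t'L; rewrite -(perm_mem pL) mem_cat t'L.
  elim: (L1) => [|t' L1' IH] sub; first by rewrite big_nil perm1.
  rewrite big_cons permM (sl t') ?sub ?mem_head // IH // => t2 t2L.
  by rewrite sub // inE t2L orbT.
have fX' x : x \notin l -> (X^-1)%g x = x by move=> /fX {1}<-; rewrite permK.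
rewrite /=.
have -> : (X * (cycle3 a b c * Y) = cycle3 ((X^-1)%g a) b c * (X * Y))%g.
  rewrite -{2}(fX' b) // -{2}(fX' c) // -cycle3J /conjg invgK.
  by rewrite !mulgA mulgKV.
set a' := (X^-1)%g a; have a'l : a' \in l by rewrite /a' (rearr_supp fX').
have [i m lm] : rot_to_spec l' a' by apply: rot_to; rewrite -ml.
(* The list is rotated so that [a'] leads; its odd length makes this even. *)
have rm : rearr false l (a' :: m).
  rewrite -lm -[false]/(false (+) false); apply: rearr_trans (rl') _.
  by apply: rearr_rot; rewrite // (rearr_size rl').
have mm := rearr_mem rm.
have um : uniq [:: b, c, a' & m].
  by rewrite 2!cons_uniq (rearr_uniq rm) ul -mm ncl in_cons -mm negb_or bc bl.
(* From [[:: b, c, a' & m]], the element [a'] crosses [c] and then [b] to reach the front: two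
   swaps, hence even. *)
exists [:: a', b, c & m].
  apply: (@rearr_trans false false _ [:: b, c, a' & m]).
    apply: rearr_cons; first by rewrite inE negb_or bc.
    exact: rearr_cons.
  rewrite -[false]/(true (+) true); apply: (@rearr_trans _ _ _ [:: b, a', c & m]).
    apply: rearr_cons; last by apply: rearr_swap; case/andP: um.
    by case/andP: um.
  apply: rearr_swap; rewrite (@perm_uniq _ _ [:: b, c, a' & m]) //.
  by rewrite perm_cons; exact/permEl/(perm_catCA [:: a'] [:: c] m).
apply: acts_as_cycle_insert; last first.
  rewrite (@perm_uniq _ _ [:: b, c, a' & m]) //.
  exact/permEl/(perm_catCA [:: a'] [:: b; c] m).
rewrite -lm; apply: acts_as_cycle_rot; exact: (conj ul' cXY).
Qed.
End CyclicOrders.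

(** * Trees grown by attaching leaf triples *)

(** A hypertree in construction order, latest triple first. The start [C] is arbitrary, so the same
    notion covers whole trees grown from one vertex and the rest attached to the five vertices of a
    fork. *)
Inductive growth (W : finType) (C : {set W}) : seq {set W} -> {set W} -> Prop :=
| GrowthNil : growth C [::] C
| GrowthLeaf ts D a b c :
    growth C ts D -> a \in D -> b \notin D -> c \notin D -> b != c ->
    growth C ([set a; b; c] :: ts) (b |: (c |: D)).

Lemma growth_imset (W W' : finType) (f : W -> W') (C D : {set W}) ts :
  injective f -> growth C ts D ->
  growth (f @: C) [seq f @: t | t : {set W} <- ts] (f @: D).
Proof.
move=> f_inj; elim=> [|{}ts {}D a b c _ IH aD bD cD bc] /=; first exact: GrowthNil.
rewrite !imsetU1 !imsetU !imset_set1.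
by apply: GrowthLeaf; rewrite ?(mem_imset _ _ f_inj) ?(inj_eq f_inj).
Qed.

Section Growth.

Variable W : finType.
Implicit Types (a b c x y z : W) (t C D E : {set W}).
Implicit Types (ts us : seq {set W}) (H : {set {set W}}) (w : {set W} -> {perm W}).

Lemma growth_trans C ts D us E :
  growth C ts D -> growth D us E -> growth C (us ++ ts) E.
Proof.
move=> gC; elim=> [|{}us {}E a b c _ IH aE bE cE bc] //=.
exact: GrowthLeaf.
Qed.

Lemma growth_sub C ts D : growth C ts D -> C \subset D.
Proof.
elim=> [|{}ts {}D a b c _ IH _ _ _ _] //; apply: subset_trans IH _.
by rewrite setUA subsetUr.
Qed.

Lemma growth_triple_sub C ts D : growth C ts D -> {in ts, forall t, t \subset D}.
Proof.
elim=> [|{}ts {}D a b c _ IH aD _ _ _] // t; rewrite inE => /orP[/eqP ->|/IH tD].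
  by apply/subsetP => x; rewrite !inE => /orP[/orP[]|] /eqP ->; rewrite ?aD ?eqxx ?orbT.
by apply: subset_trans tD _; rewrite setUA subsetUr.
Qed.

Lemma growth_uniq C ts D : growth C ts D -> uniq ts.
Proof.
elim=> [|{}ts {}D a b c g IH _ bD _ _] //=; rewrite IH andbT.
apply: contra bD => /(growth_triple_sub g)/subsetP; apply.
by rewrite !inE eqxx orbT.
Qed.

(** * Acyclicity, covering and connectedness of grown trees *)

Lemma ordS_neq l (i : 'I_l) : 2 <= l -> ordS i != i.
Proof.
move=> l2; rewrite -val_eqE /=; have [il|] := ltnP i.+1 l.
  by rewrite modn_small // neq_ltn ltnSn orbT.
move=> il; have {il} il : i.+1 = l by apply/eqP; rewrite eqn_leq ltn_ord.
by rewrite il modnn; apply: contraTneq l2 => i0; rewrite -il -i0.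
Qed.

(** A cycle through the leaf triple would enter and leave it at vertices shared with neighbouring
    triples of the cycle. Only [a] is shared with the old triples, while consecutive vertices of a
    cycle are distinct. *)
Lemma has_cycle_delete_leaf D ts a b c :
    {in ts, forall t, t \subset D} -> b \notin D -> c \notin D ->
  has_cycle [set t in [set a; b; c] :: ts] -> has_cycle [set t in ts].
Proof.
move=> tsD bD cD [l [vs [us [l2 vs_inj us_inj inc]]]].
set t0 := [set a; b; c] in inc.
exists l, vs, us; split=> // i; have [it vi vSi] := inc i; split=> //.
move: it; rewrite !inE => /orP[/eqP ut|//].
have out x j : j != i -> x \in us j -> x \in D.
  move=> ji xj; have [] := inc j; rewrite !inE -ut (inj_eq us_inj) (negbTE ji) /=.
  by move=> /tsD/subsetP sj _ _; apply: sj.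
have eq_a x j : j != i -> x \in us j -> x \in us i -> x = a.
  move=> ji /(out _ _ ji) xD; rewrite ut !inE => /orP[/orP[]|] /eqP // xe.
    by rewrite -xe xD in bD.
  by rewrite -xe xD in cD.
have vi_a : vs i = a.
  apply: (eq_a _ (ord_pred i)) => //.
    by rewrite -(inj_eq (@ordS_inj _)) ord_predK eq_sym ordS_neq.
  by have [_ _] := inc (ord_pred i); rewrite ord_predK.
have vSi_a : vs (ordS i) = a.
  apply: (eq_a _ (ordS i)) => //; first exact: ordS_neq.
  by have [] := inc (ordS i).
by have := ordS_neq i l2; rewrite -(inj_eq vs_inj) vi_a vSi_a eqxx.
Qed.

Lemma growth_acyclic a ts D : growth [set a] ts D -> ~ has_cycle [set t in ts].
Proof.
elim=> [|{}ts {}D x b c g IH xD bD cD bc].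
  by move=> [[|l] [vs [us [// _ _ _ inc]]]]; have [] := inc ord0; rewrite inE.
by move/(has_cycle_delete_leaf (growth_triple_sub g) bD cD).
Qed.

(** An empty list covers nothing although [D] is then the starting vertex; hence the size
    condition. *)
Lemma growth_cover a ts D : growth [set a] ts D -> 0 < size ts ->
  cover [set t in ts] = D.
Proof.
elim=> [|{}ts {}D x b c g IH xD bD cD bc] // _.
rewrite /cover; apply/setP => y; apply/bigcupP/idP => [[t]|].
  rewrite inE => tts; have /subsetP := growth_triple_sub (GrowthLeaf g xD bD cD bc) tts.
  exact.
have [ts0|/IH eqD] := posnP (size ts).
  have Dx : D = [set x].
    by move: g; case: (ts) ts0 => // _ g; move: xD; inversion g; rewrite inE => /eqP ->.
  rewrite Dx => yD; exists [set x; b; c]; first by rewrite inE mem_head.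
  by move: yD; rewrite !inE => /or3P[] ->; rewrite ?orbT.
rewrite !inE orbA => /orP[yt|].
  exists [set x; b; c]; first by rewrite inE mem_head.
  by rewrite !inE -orbA yt orbT.
rewrite -eqD => /bigcupP[t]; rewrite inE => tts yt.
by exists t => //; rewrite !inE tts orbT.
Qed.

Lemma share_triple_sym H : connect_sym (share_triple H).
Proof.
apply: sym_connect_sym.
by move=> x y; apply/existsP/existsP => -[t]; rewrite (andbC (_ \in t)); exists t.
Qed.

Lemma growth_connect a ts D : growth [set a] ts D ->
  {in D, forall x, connect (share_triple [set t in ts]) a x}.
Proof.
elim=> [|{}ts {}D y b c g IH yD bD cD bc] x; first by rewrite inE => /eqP ->.
set S := [set t in _].
have sub z : z \in D -> connect (share_triple S) a z.
  move/IH; apply: connect_sub => u v /exists_inP[t tts uv]; apply: connect1.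
  by apply/exists_inP; exists t => //; move: tts; rewrite !inE => ->; rewrite orbT.
rewrite !inE orbA => /orP[xbc|/sub //].
apply: connect_trans (sub y yD) (connect1 _); apply/exists_inP.
exists [set y; b; c]; first by rewrite inE mem_head.
by rewrite !inE eqxx /= -orbA xbc orbT.
Qed.

Lemma growth_spanning_tree H a ts : growth [set a] ts [set: W] -> 0 < size ts ->
  {subset ts <= H} -> spanning_tree H [set t in ts].
Proof.
move=> g ts0 tsH; split.
- by apply/subsetP => t; rewrite inE => /tsH.
- exact: growth_acyclic g.
- exact: growth_cover g ts0.
move=> x y; apply: (@connect_trans _ _ a); last by apply: (growth_connect g).
rewrite share_triple_sym.
by apply: (growth_connect g).
Qed.

(* Paths for this relation start at (set0, x): only the vertex of the first
   pair is read. *)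
Definition chain_step (u v : {set W} * W) := (u.2 \in v.1) && (v.2 \in v.1).

(** The distinctness clauses are what lets an outside triple close the chain to a cycle. In the
    induction a new endpoint is joined to the attaching vertex [u] through the new triple [t], which
    no old chain uses. *)
Lemma growth_chain a ts D : growth [set a] ts D ->
  {in D &, forall x y, exists p : seq ({set W} * W),
    [/\ path chain_step (set0, x) p /\ last x (unzip2 p) = y,
        uniq (x :: unzip2 p), uniq (unzip1 p), {subset unzip1 p <= ts} &
        {subset x :: unzip2 p <= D}]}.
Proof.
elim=> [|{}ts {}D u b c g IH uD bD cD bc] x y.
  rewrite !inE => /eqP -> /eqP ->; exists [::]; split=> // z.
  by rewrite !inE.
set t := [set u; b; c]; set D' := b |: (c |: D).
have DD' : {subset D <= D'} by move=> z zD; rewrite !inE zD !orbT.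
have D'P z : z \in D' -> z \in D \/ [/\ z \notin D, z \in t & z \in D'].
  move=> zD'; case zD: (z \in D); [by left | right; split=> //].
  by move: zD'; rewrite !inE zD orbF -orbA => ->; rewrite orbT.
have tts : t \notin ts by have /= /andP[] := growth_uniq (GrowthLeaf g uD bD cD bc).
have ut : u \in t by rewrite !inE eqxx.
(* The cases in order: both ends old, only [y] new, only [x] new, both new. *)
move=> /D'P[xD|[xD xt xD']] /D'P[yD|[yD yt yD']].
- have [p [pth up us sp sD]] := IH _ _ xD yD; exists p; split=> //.
    by move=> s /sp; rewrite inE orbC => ->.
  by move=> s /sD /DD'.
- have [p [[pth lst] up us sp sD]] := IH _ _ xD uD; exists (rcons p (t, y)).
  have -> : unzip1 (rcons p (t, y)) = rcons (unzip1 p) t by exact: map_rcons.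
  have -> : unzip2 (rcons p (t, y)) = rcons (unzip2 p) y by exact: map_rcons.
  rewrite -rcons_cons !rcons_uniq; split.
  + split; last by rewrite last_rcons.
    rewrite rcons_path pth /chain_step /= yt andbT.
    by rewrite -(last_map snd) /= lst.
  + by rewrite up andbT; apply: contra yD => /sD.
  + by rewrite us andbT; apply: contra tts => /sp.
  + by move=> s; rewrite mem_rcons !inE => /orP[->//|/sp ->]; rewrite orbT.
  + by move=> s; rewrite mem_rcons in_cons => /orP[/eqP -> //|/sD /DD'].
- have [p [[pth lst] up us sp sD]] := IH _ _ uD yD; exists ((t, u) :: p).
  rewrite -[unzip1 _]/(t :: unzip1 p) -[unzip2 _]/(u :: unzip2 p); split.
  + split=> //; rewrite /chain_step /= xt ut /=.
    by case: (p) pth.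
  + by rewrite cons_uniq up andbT; apply: contra xD => /sD.
  + by rewrite cons_uniq us andbT; apply: contra tts => /sp.
  + by move=> s; rewrite !inE => /orP[->//|/sp ->]; rewrite orbT.
  + by move=> s; rewrite in_cons => /orP[/eqP -> //|/sD /DD'].
have [<-|xy] := eqVneq x y.
  by exists [::]; split=> // s; rewrite inE => /eqP ->.
exists [:: (t, y)]; split=> //=.
- by rewrite /chain_step /= xt yt.
- by rewrite inE xy.
- by move=> s; rewrite !inE => ->.
- by move=> s; rewrite in_cons => /orP[/eqP ->//|]; rewrite inE => /eqP ->.
Qed.

Lemma chain_cycle H t x y (p : seq ({set W} * W)) :
    path chain_step (set0, x) p -> last x (unzip2 p) = y -> x != y ->
    uniq (x :: unzip2 p) -> uniq (t :: unzip1 p) ->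
    {subset t :: unzip1 p <= H} -> x \in t -> y \in t ->
  has_cycle H.
Proof.
move=> pth lst xy up ut sH xt yt.
have szp : size (x :: unzip2 p) = (size p).+1 by rewrite /= size_map.
(* [unzip1 p] is one entry shorter than the vertex list, so at the last index [nth] returns its
   default [t], the closing triple. *)
exists (size p).+1, (fun i => nth x (x :: unzip2 p) i), (fun i => nth t (unzip1 p) i).
have tE i : nth t (unzip1 p) i = nth t (rcons (unzip1 p) t) i.
  by rewrite nth_rcons; case: ltngtP => // il; rewrite nth_default ?il // ltnW.
split.
- by case: (p) lst xy => //= ->; rewrite eqxx.
- move=> i j /eqP; rewrite nth_uniq ?szp ?ltn_ord // => /eqP; exact: val_inj.
- move=> i j /eqP; rewrite !tE nth_uniq ?size_rcons ?size_map ?ltn_ord //.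
    by move/eqP; apply: val_inj.
  by rewrite rcons_uniq.
move=> i; split.
- rewrite tE; apply: sH; rewrite -(mem_rcons (unzip1 p)) mem_nth //.
  by rewrite size_rcons size_map ltn_ord.
- have [il|] := ltnP i (size p).
    rewrite -[x :: _]/(unzip2 ((set0, x) :: p)) (nth_map (set0, x)) /=; last exact: ltnW.
    rewrite (nth_map (set0, x)) //.
    by have /andP[] := pathP (set0, x) pth _ il.
  move=> il; have {il} -> : (i : nat) = size p.
    by apply/eqP; rewrite eqn_leq il -ltnS ltn_ord.
  rewrite [nth t _ _]nth_default ?size_map //.
  by rewrite -(size_map snd p) nth_last /= -/(unzip2 p) lst.
have [il|] := ltnP i (size p).
  rewrite /= modn_small ?ltnS //= (nth_map (set0, x)) // (nth_map (set0, x)) //.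
  by have /andP[] := pathP (set0, x) pth _ il.
move=> il; have {il} il : (i : nat) = size p.
    by apply/eqP; rewrite eqn_leq il -ltnS ltn_ord.
by rewrite /= il modnn /= nth_default ?size_map.
Qed.

(** * Spanning trees as growth sequences *)

(** A second common vertex would be joined to the first by a chain inside [ts], which [t] closes to
    a cycle of [H]. *)
Lemma growth_meet H a ts D t : growth [set a] ts D -> {subset ts <= H} ->
    ~ has_cycle H -> t \in H -> t \notin ts ->
  {in t &, forall x y, x \in D -> y \in D -> x = y}.
Proof.
move=> g tsH acy tH tts x y xt yt xD yD; apply/eqP; apply/negP => /negP xy.
have [p [[pth lst] up us sp _]] := growth_chain g xD yD.
apply: acy; apply: (chain_cycle pth lst xy up _ _ xt yt).
  by rewrite /= us andbT; apply: contra tts => /sp.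
by move=> s; rewrite inE => /orP[/eqP -> //|/sp /tsH].
Qed.

Lemma growth_extend H a ts D t x : growth [set a] ts D -> {subset ts <= H} ->
    ~ has_cycle H -> t \in H -> t \notin ts -> #|t| = 3 -> x \in t -> x \in D ->
  exists b c, [/\ t = [set x; b; c], b \notin D, c \notin D & b != c].
Proof.
move=> g tsH acy tH tts t3 xt xD.
have : #|t :\ x| == 2 by move: t3; rewrite (cardsD1 x) xt add1n => -[->].
move=> /cards2P[b [c [bc tx]]]; exists b, c.
have tE : t = [set x; b; c] by rewrite -(setD1K xt) tx setUA.
have out z : z \in t :\ x -> z \notin D.
  rewrite in_setD1 => /andP[zx zt]; apply: contra zx => zD.
  by apply/eqP; apply: (growth_meet g tsH acy tH tts).
by split=> //; apply: out; rewrite tx !inE eqxx ?orbT.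
Qed.

(** Greedy construction: while [D] is proper, connectedness supplies a triple of [T] leaving [D],
    acyclicity makes it a leaf, and the complement of [D] shrinks. *)
Lemma spanning_tree_growth H (T : {set {set W}}) a ts D :
    spanning_tree H T -> {in T, forall t, #|t| = 3} ->
    growth [set a] ts D -> {subset ts <= T} ->
  exists2 us, growth D us [set: W] & {subset us <= T}.
Proof.
move=> [_ acy _ con] T3.
move: {2}_.+1 (ltnSn #|~: D|) => n; elim: n => // n IH in ts D *.
rewrite ltnS => Dn g tsT; have [/setIidPl DT|] := boolP ([set: W] \subset D).
  exists [::] => //; have -> : D = [set: W] by rewrite -DT setTI.
  exact: GrowthNil.
rewrite subTset => DT.
have aD : a \in D by apply: (subsetP (growth_sub g)); rewrite inE.
have [t tT [x [y [xt yt xD yD]]]] :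
    exists2 t, t \in T & exists x y, [/\ x \in t, y \in t, x \in D & y \notin D].
  have [/exists_inP[t tT /existsP[x /existsP[y /and4P[xt yt xD yD]]]]|noT] :=
      boolP [exists t in T, [exists x, [exists y,
               [&& x \in t, y \in t, x \in D & y \notin D]]]].
    by exists t => //; exists x, y.
  (* If no triple left [D], then [D] would be closed under sharing a triple and contain everything
     connected to [a]. *)
  case/negP: DT; rewrite -subTset; apply/subsetP => y _.
  rewrite -(closed_connect _ (con a y)) //.
  apply: (intro_closed (@share_triple_sym _)).
  move=> u v /exists_inP[t tT /andP[ut vt]] uD; apply: contraR noT => vD.
  apply/exists_inP; exists t => //; apply/existsP; exists u; apply/existsP; exists v.
  by rewrite ut vt uD.
have tts : t \notin ts.
  by apply: contra yD => /(growth_triple_sub g)/subsetP; apply.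
have [b [c [tE bD cD bc]]] := growth_extend g tsT acy tT tts (T3 t tT) xt xD.
have g' : growth D [:: t] (b |: (c |: D)).
  by rewrite tE; apply: GrowthLeaf (GrowthNil _) _ _ _ _.
have [|||us gu usT] := IH (t :: ts) (b |: (c |: D)).
- apply: leq_trans Dn; apply: proper_card; apply/properP; split.
    by rewrite setCS setUA subsetUr.
  by exists b; rewrite !inE ?eqxx.
- exact: growth_trans g g'.
- by move=> s; rewrite inE => /orP[/eqP ->|/tsT].
exists (us ++ [:: t]); first exact: growth_trans g' gu.
by move=> s; rewrite mem_cat !inE => /orP[/usT //|/eqP ->].
Qed.

(** * Orientations along a growth sequence *)

Lemma oriented_triple H w t a b c : triple_orientation H w -> t \in H ->
    t = [set a; b; c] -> uniq [:: a; b; c] ->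
  w t = cycle3 a b c \/ w t = cycle3 a c b.
Proof.
move=> ori tH tE u.
have [x [y [u' tE' ->]]] : exists x y,
    [/\ uniq [:: a; x; y], t = [set a; x; y] & w t = cycle3 a x y].
  have [i [j [k [ut tE' ->]]]] := ori _ tH.
  have : a \in t by rewrite tE !inE eqxx.
  rewrite tE' !inE -orbA => /or3P[] /eqP ->.
  - by exists j, k.
  - exists k, i; split; [by rewrite -(rot_uniq 2) | | exact: cycle3_rot].
    by apply/setP => z; rewrite !inE -!orbA orbC -orbA.
  - exists i, j; split; [by rewrite -(rot_uniq 1) | |].
      by apply/setP => z; rewrite !inE -!orbA [RHS]orbC -orbA.
    by rewrite cycle3_rot // cycle3_rot // -(rot_uniq 2).
have : b \in t /\ c \in t by rewrite tE !inE !eqxx !orbT.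
rewrite tE' !inE => -[]; move: u; rewrite /= !inE andbT negb_or.
move=> /andP[/andP[ab ac] bc]; rewrite ![_ == a]eq_sym (negbTE ab) (negbTE ac) /=.
move=> /orP[]/eqP bE /orP[]/eqP cE; move: bc; rewrite bE cE ?eqxx // => _.
  by left.
by right.
Qed.

(** The order of quantifiers is the point: [X] is chosen before [ts] and [l]. Two trees with the
    same later triples thus get the same prefix, which drops out of the comparison of their
    signs. *)
Lemma growth_order H w C us D : triple_orientation H w ->
    growth C us D -> {subset us <= H} ->
  exists X, forall ts l, tree_order w ts l -> l =i C ->
    tree_order w (us ++ ts) (X ++ l) /\ X ++ l =i D.
Proof.
move=> ori; elim=> [|{}us {}D a b c g IH aD bD cD bc] usH; first by exists [::].
have [X XP] : exists X, forall ts l, tree_order w ts l -> l =i C ->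
    tree_order w (us ++ ts) (X ++ l) /\ X ++ l =i D.
  by apply: IH => t tus; apply: usH; rewrite inE tus orbT.
have u3 : uniq [:: a; b; c].
  by rewrite /= !inE bc !andbT negb_or; apply/andP; split; apply: contraTneq aD => ->.
have [wt|wt] := oriented_triple ori (usH _ (mem_head _ _)) erefl u3.
  exists [:: b, c & X] => ts l tl lC; have [tX mX] := XP ts l tl lC; split.
    apply: tree_order_leaf (tX) _ _ wt; first by rewrite mX.
    by have [uX _ _ _] := tX; rewrite /= uX inE !negb_or bc !mX bD cD.
  by move=> z; rewrite /= !inE mX.
exists [:: c, b & X] => ts l tl lC; have [tX mX] := XP ts l tl lC; split.
  apply: tree_order_leaf (tX) _ _ wt; first by rewrite mX.
  by have [uX _ _ _] := tX; rewrite /= uX inE !negb_or eq_sym bc !mX bD cD.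
by move=> z; rewrite /= !inE mX orbCA.
Qed.

End Growth.

Lemma growth2 (W : finType) (a b c x y : W) : uniq [:: a; b; c; x; y] ->
  growth [set a] [:: [set a; c; y]; [set a; b; x]] [set a; b; c; x; y].
Proof.
rewrite /= !inE !negb_or andbT.
case/and4P => /and4P[ab ac ax ay] /and3P[bc bx bY] /andP[cx cy] xy.
have -> : [set a; b; c; x; y] = c |: (y |: (b |: (x |: [set a]))).
  by apply/setP => z; rewrite !inE; do 5 case: (z == _) => //.
apply: GrowthLeaf => //;
  rewrite ?inE ?eqxx ?orbT ?negb_or ?(eq_sym _ a) ?ac ?ay ?(eq_sym c b) ?bc ?cx;
  rewrite ?(eq_sym y) ?bY ?xy //.
apply: GrowthLeaf => //; rewrite ?inE ?eqxx ?orbT ?negb_or ?(eq_sym _ a) //.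
exact: GrowthNil.
Qed.

(** * Signs of spanning trees *)

Section Sign.

Variables (W : finType) (N : nat) (v : 'I_N -> W).
Hypothesis v_bij : bijective v.
Implicit Types (g : {perm W}) (s : 'S_N) (l : seq W) (w : {set W} -> {perm W}).

(** [g] is written as a product of transpositions, each transported along [v] to a transposition of
    indices. *)
Lemma perm_transport g :
  exists s, odd_perm s = odd_perm g /\ forall i, v (s i) = g (v i).
Proof.
have [u vK uK] := v_bij.
have [ts -> _] := prod_tpermP g; elim: ts => [|[x y] ts [s [os sv]]].
  by exists 1%g; rewrite big_nil !odd_perm1; split=> // i; rewrite !perm1.
exists (tperm (u x) (u y) * s)%g; rewrite big_cons !odd_permM os !odd_tperm.
rewrite (can_eq uK); split=> // i.
by rewrite !permM sv /= (inj_tperm _ _ _ (can_inj vK)) !uK.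
Qed.

(** Two listings of one cycle differ by a permutation [h] commuting with the cyclic shift [z], hence
    by a power of [z]; and [z] is even because its [N]-th power is trivial with [N] odd. *)
Lemma odd_is_Ncycle c s s' :
  odd N -> is_Ncycle v c s -> is_Ncycle v c s' -> odd_perm s = odd_perm s'.
Proof.
move=> oN /forallP cs /forallP cs'; have v_inj := bij_inj v_bij.
pose z : 'S_N := perm (@ordS_inj N).
have zE k (i : 'I_N) : val ((z ^+ k)%g i) = (i + k) %% N.
  elim: k => [|k IH]; first by rewrite expg0 perm1 addn0 modn_small.
  by rewrite expgSr permM permE /= IH -addn1 modnDml addn1 addnS.
have z1 : (z ^+ N = 1)%g.
  by apply/permP => i; apply: val_inj; rewrite zE perm1 modnDr modn_small.
have odd_permX k : odd_perm (z ^+ k)%g = odd k && odd_perm z.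
  elim: k => [|k IH]; first by rewrite expg0 odd_perm1.
  by rewrite expgS odd_permM IH /=; case: (odd k); case: (odd_perm z).
have oz k : odd_perm (z ^+ k)%g = false.
  have : odd_perm z = false.
    have : odd_perm (z ^+ N)%g = odd_perm z by rewrite odd_permX oN.
    by rewrite z1 odd_perm1.
  by rewrite odd_permX => ->; rewrite andbF.
have [h hE] : exists h, h = (s' * s^-1)%g by exists (s' * s^-1)%g.
have hS i : h (ordS i) = ordS (h i).
  rewrite hE !permM; apply: (@perm_inj _ s); rewrite permKV; apply: v_inj.
  by rewrite -(eqP (cs' i)) -(eqP (cs _)) permKV.
have N0 : 0 < N by case: (N) oN.
(* A map commuting with the shift is determined by the image of the index 0. *)
suff hz : h = (z ^+ h (Ordinal N0))%g.
  have : odd_perm h = false by rewrite hz oz.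
  rewrite hE.
  by rewrite odd_permM odd_permV; case: (odd_perm s); case: (odd_perm s').
have hk k : h ((z ^+ k)%g (Ordinal N0)) = (z ^+ k)%g (h (Ordinal N0)).
  elim: k => [|k IH]; first by rewrite expg0 !perm1.
  by rewrite expgSr !permM !permE hS IH.
have z0 (i : 'I_N) : (z ^+ i)%g (Ordinal N0) = i.
  by apply: val_inj; rewrite zE add0n modn_small.
apply/permP => i; rewrite -{1}(z0 i) hk -{1}(z0 (h _)) -{2}(z0 i).
by rewrite -!permM -!expgD addnC.
Qed.

Lemma acts_as_cycle_Ncycle c l : acts_as_cycle c l -> size l = N ->
  exists2 s, is_Ncycle v c s & forall i, v (s i) = nth (v i) l i.
Proof.
move=> [ul cl] sl; have [u vK uK] := v_bij.
have f_inj : injective (fun i : 'I_N => u (nth (v i) l i)).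
  move=> i j /(can_inj uK); rewrite (set_nth_default (v j)) ?sl ?ltn_ord //.
  by move/eqP; rewrite nth_uniq ?sl ?ltn_ord // => /eqP; apply: val_inj.
have sE i : v (perm f_inj i) = nth (v i) l i by rewrite permE uK.
exists (perm f_inj) => //; apply/forallP => i; rewrite !sE cl.
have -> : nth (v (ordS i)) l (ordS i) = nth (v i) l (ordS i).
  by apply: set_nth_default; rewrite sl ltn_ord.
have il : i < size l by rewrite sl ltn_ord.
rewrite next_nth mem_nth // index_uniq //=.
rewrite -[X in _ %% X]sl; case: (l) il => //= x l'.
rewrite ltnS leq_eqVlt => /orP[/eqP il|il].
  (* At the last index [next] falls back on its default, the head of the list, matching the wrap of
     [ordS]. *)
  by rewrite il modnn nth_default.
by rewrite modn_small //=; apply/eqP/set_nth_default.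
Qed.

Lemma sgn_acts_as_cycle w (T : {set {set W}}) l : odd N ->
    acts_as_cycle (\prod_(t in T) w t)%g l -> size l = N ->
  exists2 s : 'S_N, sgn v w T = ((-1) ^+ s)%R & forall i, v (s i) = nth (v i) l i.
Proof.
move=> oN cl sl; have [s cs sE] := acts_as_cycle_Ncycle cl sl; exists s => //.
rewrite /sgn; case: pickP => [s' cs'|/(_ s)]; last by rewrite cs.
by rewrite (odd_is_Ncycle oN cs cs').
Qed.

(** The product over a set follows the set's own enumeration; this is where the freedom of [L] in
    [tree_order] is used. *)
Lemma tree_order_prod w ts l : tree_order w ts l -> uniq ts ->
  exists2 l', rearr false l l' & acts_as_cycle (\prod_(t in [set t in ts]) w t)%g l'.
Proof.
move=> [_ _ _ cl] uts.
rewrite -big_filter; apply: cl; apply: uniq_perm => //.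
  by rewrite filter_uniq // index_enum_uniq.
by move=> t; rewrite mem_filter mem_index_enum andbT inE.
Qed.

(** A rearrangement of parity [d] multiplies the sign by [-1] to the power [d]. *)
Lemma eq_sgn_rearr w ts ts' l l' d : odd N -> size l = N ->
    tree_order w ts l -> tree_order w ts' l' -> uniq ts -> uniq ts' ->
    rearr d l l' -> sgn v w [set t in ts] = sgn v w [set t in ts'] ->
  d = false.
Proof.
move=> oN sl tl tl' uts uts' r.
have [m rm cm] := tree_order_prod tl uts.
have [m' rm' cm'] := tree_order_prod tl' uts'.
have {}r : rearr d m m'.
  rewrite -[d]/(false (+) d) -[false (+) d]addbF.
  by apply: rearr_trans rm'; apply: rearr_trans r; apply: rearr_sym.
have sm : size m = N by rewrite (rearr_size rm).
have [s -> sE] := sgn_acts_as_cycle oN cm sm.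
have [s' -> s'E] := sgn_acts_as_cycle oN cm' (etrans (rearr_size r) sm).
case: r s'E => g [<- _ ->] s'E.
have [h [<- hE]] := perm_transport g.
have -> : s' = (s * h)%g.
  apply/permP => i; apply: (bij_inj v_bij); rewrite s'E permM hE sE.
  rewrite -(nth_map _ (v i)) ?sm ?ltn_ord //.
by rewrite odd_permM; case: (odd_perm s); case: (odd_perm h).
Qed.

(** * Comparison of two trees that differ in two triples *)

Variables (H : {set {set W}}) (w : {set W} -> {perm W}).
Hypotheses (ori : triple_orientation H w) (pf : pfaffian3 v H w).

Definition reversed a b c := w [set a; b; c] != cycle3 a b c.

Lemma reversedP a b c : uniq [:: a; b; c] -> [set a; b; c] \in H ->
  w [set a; b; c] = if reversed a b c then cycle3 a c b else cycle3 a b c.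
Proof.
move=> u tH; rewrite /reversed; have [->|] := eqVneq; first by [].
by case: (oriented_triple ori tH erefl u) => -> //; rewrite eqxx.
Qed.

(** Each triple puts its two new vertices in front of the list, giving [[:: c; q; b; p; a]] when
    nothing is reversed; a reversed triple swaps its own pair, one transposition each. *)
Lemma tree_order2 a b c p q : uniq [:: a; b; c; p; q] ->
    [set a; b; p] \in H -> [set a; c; q] \in H ->
  exists2 l, tree_order w [:: [set a; c; q]; [set a; b; p]] l &
    rearr (reversed a c q (+) reversed a b p) [:: c; q; b; p; a] l.
Proof.
move=> u tH1 tH2.
have step ts x y l0 l d : tree_order w ts l -> rearr d l0 l -> a \in l0 ->
    uniq [:: x, y & l0] -> [set a; x; y] \in H ->
  exists2 l', tree_order w ([set a; x; y] :: ts) l' &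
    rearr (reversed a x y (+) d) [:: x, y & l0] l'.
  move=> tl r al ul tH; have ml := rearr_mem r.
  have ul' : uniq [:: x, y & l].
    by move: ul; rewrite /= !inE !ml (rearr_uniq r).
  have uy : uniq [:: y, x & l].
    by move: ul'; rewrite /= !inE !negb_or eq_sym => /and3P[/andP[-> ->] -> ->].
  have r2 : rearr d [:: x, y & l0] [:: x, y & l].
    by apply: (@rearr_cat _ d [:: x; y]).
  have u3 : uniq [:: a; x; y].
    rewrite -(rot_uniq 1) -[rot _ _]/([:: x; y; a]).
    move: ul; rewrite /= !inE !negb_or => /and3P[/andP[-> xl] yl _]; rewrite !andbT /=.
    by apply/andP; split; [apply: contraNneq xl | apply: contraNneq yl] => ->.
  have := reversedP u3 tH; case: (reversed a x y) => wt.
    exists [:: y, x & l]; last by rewrite addbC; apply: rearr_trans r2 (rearr_swap ul').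
    by apply: tree_order_leaf tl _ uy wt; rewrite -ml.
  exists [:: x, y & l] => //.
  by apply: tree_order_leaf tl _ ul' wt; rewrite -ml.
move: u; rewrite /= !inE !negb_or.
case/and4P => /and4P[ab ac ap aq] /and3P[bc bp bq] /andP[cp cq] pq.
rewrite andbT in pq.
have [l1 tl1 r1] : exists2 l', tree_order w [:: [set a; b; p]] l' &
    rearr (reversed a b p (+) false) [:: b; p; a] l'.
  apply: step (tree_order1 w a) (rearr_refl _) _ _ tH1; first exact: mem_head.
  by rewrite /= !inE negb_or bp !(eq_sym _ a) ab ap.
rewrite -[reversed a b p]addbF.
apply: step tl1 r1 _ _ tH2; first by rewrite !inE eqxx !orbT.
rewrite /= !inE !negb_or bp !(eq_sym _ a) ab ap ac aq cq (eq_sym c) bc cp.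
by rewrite !(eq_sym q) bq pq.
Qed.

(** Both trees consist of a fork on the same five vertices followed by [us]. Their orders share the
    prefix [X], and the fork orders differ by the transposition of [p] and [q] together with one
    swap per reversed triple. Equal signs make the total even, so the four bits have an odd sum. *)
Lemma pfaffian_swap a b c p q us : uniq [:: a; b; c; p; q] ->
    [set a; b; p] \in H -> [set a; c; q] \in H ->
    [set a; b; q] \in H -> [set a; c; p] \in H ->
    growth [set a; b; c; p; q] us [set: W] -> {subset us <= H} ->
  reversed a b p (+) reversed a c p != reversed a b q (+) reversed a c q.
Proof.
move=> u bpH cqH bqH cpH g usH.
have u' : uniq [:: a; b; c; q; p].
  rewrite (@perm_uniq _ _ [:: a; b; c; p; q]) // !perm_cons.
  exact/permEl/(perm_catC [:: q] [:: p]).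
have [X XP] := growth_order ori g usH.
have ml x y : uniq [:: a; b; c; x; y] -> [:: c; y; b; x; a] =i [set a; b; c; x; y].
  by move=> _ z; rewrite !inE; do 5 case: (z == _) => //.
have gT := growth_trans (growth2 u) g.
have gT' : growth [set a] (us ++ [:: [set a; c; p]; [set a; b; q]]) [set: W].
  apply: growth_trans (growth2 u') _.
  by have -> : [set a; b; c; q; p] = [set a; b; c; p; q] by rewrite setUAC.
have [l tl r] := tree_order2 u bpH cqH.
have [l' tl' r'] := tree_order2 u' bqH cpH.
have [tX mX] := XP _ _ tl (fun z => etrans (esym (rearr_mem r z)) (ml _ _ u z)).
have ml' : l' =i [set a; b; c; p; q].
  by move=> z; rewrite -(rearr_mem r') (ml _ _ u') setUAC.
have [tX' mX'] := XP _ _ tl' ml'.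
(* A tree order of the whole tree lists every vertex once, so [N] is its length and in particular
   odd. *)
have sN : size (X ++ l) = N.
  have [uX _ _ _] := tX; rewrite -(card_uniqP uX) (eq_card mX) cardsT.
  by rewrite -(bij_eq_card v_bij) card_ord.
have oN : odd N by have [_ + _ _] := tX; rewrite sN.
have rt : rearr true [:: c; q; b; p; a] [:: c; p; b; q; a].
  move: (u); rewrite /= !inE !negb_or andbT.
  case/and4P => /and4P[ab ac ap aq] /and3P[bc bp bq] /andP[cp cq] pq.
  exists (tperm p q); split; first by rewrite odd_tperm pq.
    by move=> x; rewrite !inE !negb_or => /and5P[_ xq _ xp _]; rewrite tpermD // eq_sym.
  by rewrite /= tpermL tpermR !tpermD // eq_sym.
have rl := rearr_trans (rearr_trans (rearr_sym r) rt) r'.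
have [uX _ _ _] := tX.
have stH x y : [set a; b; x] \in H -> [set a; c; y] \in H ->
    {subset us ++ [:: [set a; c; y]; [set a; b; x]] <= H}.
  by move=> h1 h2 t; rewrite mem_cat !inE => /or3P[/usH //|/eqP ->|/eqP ->].
have T1 := growth_spanning_tree gT _ (stH _ _ bpH cqH).
have T2 := growth_spanning_tree gT' _ (stH _ _ bqH cpH).
rewrite !size_cat !addnS in T1 T2.
have := eq_sgn_rearr oN sN tX tX' (growth_uniq gT) (growth_uniq gT') (rearr_cat uX rl)
  (pf (T1 isT) (T2 isT)).
by do 4 case: (reversed _ _ _).
Qed.

End Sign.

(** * Forks in suspensions *)

Section Suspension.

Variables (U V : finType) (e : rel V).
Hypotheses (e_sym : symmetric e) (e_irr : irreflexive e).
Implicit Types (p q r : U) (a b c : V) (t : {set U + V}).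

Notation H := (suspension U e).

Lemma mem_suspension a b p : e a b -> [set inr a; inr b; inl p] \in H.
Proof.
move=> ab; rewrite inE; apply/existsP; exists a; apply/existsP; exists b.
by apply/existsP; exists p; rewrite ab eqxx.
Qed.

Lemma suspensionP t : t \in H ->
  exists a b p, e a b /\ t = [set inr a; inr b; inl p].
Proof.
rewrite inE => /existsP[a /existsP[b /existsP[p /andP[ab /eqP tE]]]].
by exists a, b, p.
Qed.

Lemma suspension_link t a : t \in H -> inr a \in t ->
  exists b p, e a b /\ t = [set inr a; inr b; inl p].
Proof.
move=> /suspensionP[x [y [p [xy ->]]]]; rewrite !inE orbF => /orP[]/eqP[->].
  by exists y, p.
by exists x, p; rewrite e_sym; split=> //; rewrite (setUC [set _]).
Qed.

Lemma edge_neq a b : e a b -> a != b.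
Proof. by apply: contraTneq => ->; rewrite e_irr. Qed.

Lemma fork_uniq a b c p q : e a b -> e a c -> b != c -> p != q ->
  uniq [:: inr a; inr b; inr c; inl p; inl q : U + V].
Proof.
move=> /edge_neq ab /edge_neq ac bc pq; rewrite /= !inE /= !orbF !andbT.
by rewrite negb_or -!sum_eqE /= ab ac bc pq.
Qed.

Lemma suspension_card3 t : t \in H -> #|t| = 3.
Proof.
move=> /suspensionP[a [b [p [ab ->]]]].
by rewrite setUC cardsU1 cards2 !inE /= (inj_eq inr_inj) (edge_neq ab).
Qed.

(** Without two triples meeting in a vertex of [V], the triples through [p] would be closed off:
    they could be left neither at a vertex of [V] nor at [p], their only vertex in [U]. Then [q]
    would be out of reach. *)
Lemma suspension_fork (T : {set {set U + V}}) p q : spanning_tree H T -> p != q ->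
  exists a t1 t2, [/\ t1 \in T, t2 \in T, t1 != t2, inr a \in t1 & inr a \in t2].
Proof.
move=> [TH _ _ con] pq.
pose fork (a : V) := [exists t1 in T, [exists t2 in T,
  [&& t1 != t2, inr a \in t1 & inr a \in t2]]].
have [/existsP[a /exists_inP[t1 t1T /exists_inP[t2 t2T /and3P[t12 a1 a2]]]]|nofork] :=
    boolP [exists a, fork a].
  by exists a, t1, t2.
pose S : {set U + V} := inl p |: \bigcup_(t in T | inl p \in t) t.
suff : inl q \in S.
  rewrite !inE (inj_eq inl_inj) eq_sym (negbTE pq) /=.
  move=> /bigcupP[t /andP[/(subsetP TH)/suspensionP[a [b [r [_ ->]]]]]].
  by rewrite !inE /= => /eqP[pr] /eqP[qr]; rewrite pr qr eqxx in pq.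
rewrite -(closed_connect _ (con (inl p) (inl q))); first by rewrite !inE eqxx.
apply: (intro_closed (@share_triple_sym _ _)) => x y /exists_inP[t tT /andP[xt yt]].
have in_S s : s \in T -> inl p \in s -> y \in s -> y \in S.
  by move=> sT ps ys; rewrite inE; apply/orP; right; apply/bigcupP; exists s; rewrite ?sT.
rewrite inE => /orP[|/bigcupP[s /andP[sT ps] xs]].
  by rewrite inE => /eqP xp; apply: (in_S t) => //; rewrite -xp.
case: x xs xt => [r|a] xs xt.
  have rp : r = p.
    have [a [b [u [_ sE]]]] := suspensionP (subsetP TH _ sT).
    by move: ps xs; rewrite sE !inE /= => /eqP[->] /eqP[->].
  by apply: (in_S t) => //; rewrite -rp.
have [st|st] := eqVneq s t; first by apply: in_S sT ps _; rewrite st.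
case/negP: nofork; apply/existsP; exists a; apply/exists_inP; exists s => //.
by apply/exists_inP; exists t => //; rewrite st xs xt.
Qed.

(** Only the triples attached to the fork are kept, and they are asked to lie in the suspension
    rather than in a fixed tree, so that permutations of [U] preserve the property. *)
Definition fork_growth a b c p q : Prop :=
  exists2 us, growth [set inr a; inr b; inr c; inl p; inl q] us [set: U + V] &
    {subset us <= H}.

(** A permutation of [U], extended by the identity on [V], is an automorphism of the suspension and
    carries growth sequences to growth sequences. *)
Lemma fork_growth_perm a b c p q (s : {perm U}) :
  fork_growth a b c p q -> fork_growth a b c (s p) (s q).
Proof.
move=> [us g usH].
pose f (x : U + V) : U + V := if x is inl u then inl (s u) else x.
have f_inj : injective f by move=> [u|x] [u'|x'] //= [/perm_inj ->].
exists [seq f @: t | t : {set U + V} <- us].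
  have := growth_imset f_inj g; rewrite !imsetU !imset_set1 /=.
  suff -> : f @: [set: U + V] = [set: U + V] by [].
  by apply/eqP; rewrite eqEcard subsetT (card_imset _ f_inj) leqnn.
move=> _ /mapP[t /usH/suspensionP[x [y [r [xy ->]]]] ->].
by rewrite !imsetU !imset_set1 mem_suspension.
Qed.

Lemma spanning_tree_fork (T : {set {set U + V}}) p q : spanning_tree H T -> p != q ->
  exists a b c p' q', [/\ e a b, e a c, b != c, p' != q' & fork_growth a b c p' q'].
Proof.
move=> sT pq; have [a [t1 [t2 [t1T t2T t12 a1 a2]]]] := suspension_fork sT pq.
have [TH acy _ _] := sT.
have [b [p1 [ab t1E]]] := suspension_link (subsetP TH _ t1T) a1.
have [c [q1 [ac t2E]]] := suspension_link (subsetP TH _ t2T) a2.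
have g1 : growth [set inr a] [:: t1] (inr b |: (inl p1 |: [set inr a])).
  rewrite t1E; apply: GrowthLeaf (GrowthNil _) _ _ _ _; rewrite ?inE //.
  by apply: contraTneq ab => -[->]; rewrite e_irr.
have t1T' : {subset [:: t1] <= T} by move=> t; rewrite inE => /eqP ->.
have t2n : t2 \notin [:: t1] by rewrite inE eq_sym.
(* The first triple alone is a growth sequence, so [t2] meets it only in [a]; both [b != c] and
   [p1 != q1] follow from this. *)
have meet x : x \in t2 -> x \in inr b |: (inl p1 |: [set inr a]) -> x = inr a.
  by move=> x2 xD; apply: (growth_meet g1 t1T' acy t2T t2n); rewrite // !inE eqxx !orbT.
have bc : b != c.
  apply/eqP => bc; have : inr b = inr a :> U + V.
    by apply: meet; rewrite ?t2E -?bc !inE eqxx ?orbT.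
  by move=> [ba]; move: ab; rewrite ba e_irr.
have pq1 : p1 != q1.
  apply/eqP => pq1; suff : inl p1 = inr a :> U + V by [].
  by apply: meet; rewrite ?t2E -?pq1 !inE eqxx ?orbT.
exists a, b, c, p1, q1; split=> //.
have u := fork_uniq ab ac bc pq1.
have [||us gu usT] := spanning_tree_growth sT _ (growth2 u).
- by move=> t /(subsetP TH)/suspension_card3.
- by move=> t; rewrite !inE -t1E -t2E => /orP[] /eqP ->.
by exists us => // t /usT /(subsetP TH).
Qed.
End Suspension.

(** * The contradiction for three or more suspension vertices *)

Theorem theorem5p2 (V : finType) (e : rel V)
    (e_sym : symmetric e) (e_irr : irreflexive e)
    (k : nat) (k_ge3 : 3 <= k) (U : finType) (card_U : #|U| = k)
    (N : nat) (v : 'I_N -> (U + V)%type) (v_bij : bijective v) :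
  (exists T : {set {set U + V}}, spanning_tree (suspension U e) T) ->
  ~ (exists w : {set U + V} -> {perm U + V},
       triple_orientation (suspension U e) w /\
       pfaffian3 v (suspension U e) w).
Proof.
move=> [T sT] [w [ori pf]].
have [p0 [q0 [_ _ pq0]]] : exists p0 q0 : U, [/\ p0 \in U, q0 \in U & p0 != q0].
  by apply/card_gt1P; rewrite card_U; apply: ltnW.
have [a [b [c [p [q [ab ac bc pq g]]]]]] := spanning_tree_fork e_sym e_irr sT pq0.
have /card_gt0P[r] : 0 < #|~: [set p; q]|.
  by rewrite cardsCs setCK cards2 pq card_U subn_gt0.
rewrite !inE negb_or => /andP[rp rq].
pose f x := reversed w (inr a) (inr b) (inl x) (+) reversed w (inr a) (inr c) (inl x).
have key x y : x != y -> fork_growth e a b c x y -> f x != f y.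
  move=> xy [us gu usH].
  by apply: (pfaffian_swap v_bij ori pf (fork_uniq e_irr ab ac bc xy) _ _ _ _ gu usH);
    apply: mem_suspension.
have fpq := key _ _ pq g.
(* Transposing [q] and [r] turns the pair [p], [q] into [p], [r]; transposing [p] and [q] then gives
   [q], [r]. *)
have gpr : fork_growth e a b c p r.
  by have := fork_growth_perm (tperm q r) g; rewrite tpermL tpermD // eq_sym.
have gqr : fork_growth e a b c q r.
  by have := fork_growth_perm (tperm p q) gpr; rewrite tpermL tpermD // eq_sym.
have := key _ _ _ gpr; have := key _ _ _ gqr; move: fpq.
rewrite ![_ == r]eq_sym rp rq.
(* Three booleans cannot be pairwise different. *)
by case: (f p); case: (f q); case: (f r) => //= _ /(_ isT) // _ /(_ isT).
Qed.
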